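(* Let $\varepsilon>0$ and let $\{(\Phi_k,\alpha_k,W_k)\}_{k\ge 0}$ be the (deterministic) sequence of progress measures $\Phi_k\ge 0$, stepsize parameters $\alpha_k$ and success indicators $W_k$ associated with a run of the adaptive deterministic framework (described in the context), and let $T_\varepsilon\in\{0,1,2,\dots\}\cup\{\infty\}$ be the stopping time. Suppose the following condition holds. (1) There exists a scalar $\underline\alpha_\varepsilon\in(0,\infty)$ such that for each $k$ with $\alpha_k\le\gamma\underline\alpha_\varepsilon$ the iteration is successful, i.e., $W_k=1$; and therefore $\alpha_k\ge\underline\alpha_\varepsilon$ for all $k\ge 0$. (2) There exist a nondecreasing function $h_\varepsilon:[0,\infty)\to(0,\infty)$ and a scalar $\Theta\in(0,\infty)$ such that $\Phi_k-\Phi_{k+1}\ge\Theta h_\varepsilon(\alpha_k)$ for all $k<T_\varepsilon$. Then $$T_\varepsilon\le\frac{\Phi_0}{\Theta\, h_\varepsilon(\underline\alpha_\varepsilon)}.$$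
   Context: Adaptive deterministic framework for minimizing $f:\mathbb{R}^n\to\mathbb{R}$. Constants: $\eta\in(0,1)$, $\gamma\in(1,\infty)$, $\overline\alpha\in(0,\infty)$; initial iterate $x_0\in\mathbb{R}^n$ and $\alpha_0\in(0,\overline\alpha]$. For each $k=0,1,2,\dots$: choose a local model $m_k$ of $f$ around $x_k$ and compute a trial step $s_k(\alpha_k)$ with $m_k(x_k)-m_k(x_k+s_k(\alpha_k))\ge 0$ sufficiently large; check whether $f(x_k)-f(x_k+s_k(\alpha_k))$ is sufficiently large relative to the model reduction, using a condition parameterized by $\eta$ (possibly along with other requirements). If so, the iteration is successful, and $x_{k+1}=x_k+s_k(\alpha_k)$, $\alpha_{k+1}=\min\{\gamma\alpha_k,\overline\alpha\}$. Otherwise it is unsuccessful, and $x_{k+1}=x_k$, $\alpha_{k+1}=\gamma^{-1}\alpha_k$. The indicator $W_k$ equals $1$ if iteration $k$ is successful and $-1$ otherwise. The sequence $\{\Phi_k\}$ is any sequence of nonnegative reals used to measure progress. The stopping time $T_\varepsilon$ is the index of the first iterate satisfying a given convergence criterion parameterized by $\varepsilon$ ($T_\varepsilon=\infty$ if there is none). In item (1), the lower bound $\alpha_k\ge\underline\alpha_\varepsilon$ for all $k$ (in particular $\alpha_0\ge\underline\alpha_\varepsilon$) is understood to be part of the condition. *)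

(* Defs.v *)
From mathcomp Require Import all_boot all_order all_algebra.
From mathcomp Require Import boolp reals constructive_ereal.

Set Implicit Arguments.
Unset Strict Implicit.
Unset Printing Implicit Defensive.
Import Order.TTheory GRing.Theory Num.Theory.
Local Open Scope ring_scope.

Definition upward_closed (R : realType) (P : R -> Prop) : Prop :=
  forall d d' : R, d <= d' -> P d -> P d'.

(** The framework leaves the tests "sufficiently large" open; each is an
    arbitrary predicate, upward closed in the reduction being tested:
    - [model_red_large k x m a s d]: the reduction [d] of the model [m] obtained
      with the step [s] from the iterate [x], with stepsize parameter [a], is
      sufficiently large;
    - [obj_red_large eta dm df]: the reduction [df] of the objective is
      sufficiently large relative to the model reduction [dm];
    - [other_req k x m a s]: the possible other requirements for success (take
      it always true if there are none). *)
Record framework (R : realType) (n : nat) := Framework {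
  objective : 'rV[R]_n -> R;
  eta : R;
  gamma : R;
  alpha_max : R;
  model_red_large :
    nat -> 'rV[R]_n -> ('rV[R]_n -> R) -> R -> 'rV[R]_n -> R -> Prop;
  obj_red_large : R -> R -> R -> Prop;
  other_req : nat -> 'rV[R]_n -> ('rV[R]_n -> R) -> R -> 'rV[R]_n -> Prop;
  eta_bounds : 0 < eta < 1;
  gamma_gt1 : 1 < gamma;
  alpha_max_gt0 : 0 < alpha_max;
  model_red_large_up : forall k x m a s, upward_closed (model_red_large k x m a s);
  obj_red_large_up : forall e dm, upward_closed (obj_red_large e dm)
}.

(** [step k a] is the trial step s_k(a); only its value at [a = alpha k] is
    used by the iteration. *)
Record history (R : realType) (n : nat) := History {
  iterate : nat -> 'rV[R]_n;
  alpha : nat -> R;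
  model : nat -> 'rV[R]_n -> R;
  step : nat -> R -> 'rV[R]_n
}.

Section Run.
Variables (R : realType) (n : nat) (F : framework R n) (A : history R n).

Definition trial_step (k : nat) : 'rV[R]_n := step A k (alpha A k).

Definition model_reduction (k : nat) : R :=
  model A k (iterate A k) - model A k (iterate A k + trial_step k).

Definition objective_reduction (k : nat) : R :=
  objective F (iterate A k) - objective F (iterate A k + trial_step k).

Definition successful (k : nat) : Prop :=
  obj_red_large F (eta F) (model_reduction k) (objective_reduction k) /\
  other_req F k (iterate A k) (model A k) (alpha A k) (trial_step k).

Definition W (k : nat) : int := if `[< successful k >] then 1 else -1.

Record is_run : Prop := IsRun {
  run_alpha0 : 0 < alpha A 0 <= alpha_max F;
  run_model_red_ge0 : forall k, 0 <= model_reduction k;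
  run_model_red_large : forall k,
    model_red_large F k (iterate A k) (model A k) (alpha A k) (trial_step k)
      (model_reduction k);
  run_successful : forall k, successful k ->
    iterate A k.+1 = iterate A k + trial_step k /\
    alpha A k.+1 = Num.min (gamma F * alpha A k) (alpha_max F);
  run_unsuccessful : forall k, ~ successful k ->
    iterate A k.+1 = iterate A k /\
    alpha A k.+1 = (gamma F)^-1 * alpha A k
}.

(** The least index whose iterate meets the criterion with parameter [eps], as
    an extended real; [+oo] when there is none. *)
Definition stopping_time (criterion : R -> 'rV[R]_n -> Prop) (eps : R) : \bar R :=
  match pselect (exists k, `[< criterion eps (iterate A k) >]) with
  | left ex => ((ex_minn ex)%:R)%:E
  | right _ => +oo%E
  end.

End Run.

(* Main.v *)
Require Import Defs.
From mathcomp Require Import all_boot all_order all_algebra.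
From mathcomp Require Import boolp reals constructive_ereal.

Set Implicit Arguments.
Unset Strict Implicit.
Unset Printing Implicit Defensive.
Import Order.TTheory GRing.Theory Num.Theory.
Local Open Scope ring_scope.

(** While the process runs, the stepsize stays above its lower bound, so each
    iteration costs the nonnegative measure at least a fixed amount [c]; summing
    the decreases, [N] iterations cost [N * c <= Phi 0]. By the Archimedean
    property this also rules out an infinite stopping time. *)

(** Any finite [N] is allowed and decrease is needed only before it, so this serves both for a
    finite stopping index and for an [N] chosen at will when there is none. *)
Lemma steps_le_of_decrease (R : realFieldType) (u : nat -> R) (c : R) (N : nat) :
  0 < c -> 0 <= u N -> (forall k, (k < N)%N -> c <= u k - u k.+1) ->
  N%:R <= u 0%N / c.
Proof.
move=> c_gt0 uN_ge0 dec.
have sum_dec : N%:R * c <= u 0%N - u N.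
  have <- : \sum_(0 <= k < N) (u k - u k.+1) = u 0%N - u N.
    (* [telescope_sumr] sums the increments [u k.+1 - u k], hence the sign changes. *)
    rewrite -[RHS]opprB -(telescope_sumr u (leq0n N)) -sumrN.
    by apply: eq_bigr => k _; rewrite opprB.
  rewrite mulr_natl -[N in c *+ N]subn0 -sumr_const_nat.
  by rewrite !big_mkord; apply: ler_sum => k _; apply: dec.
rewrite ler_pdivlMr //; apply: le_trans sum_dec _.
by rewrite gerBl.
Qed.

Theorem mainTheorem1 (R : realType) (n : nat)
    (F : framework R n) (A : history R n) (hrun : is_run F A)
    (criterion : R -> 'rV[R]_n -> Prop)
    (eps : R) (heps : 0 < eps)
    (Phi : nat -> R) (hPhi : forall k : nat, 0 <= Phi k)
    (alpha_low : R) (halpha_low : 0 < alpha_low)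
    (hsuccess : forall k : nat, alpha A k <= gamma F * alpha_low -> W F A k = 1)
    (hlower : forall k : nat, alpha_low <= alpha A k)
    (h : R -> R) (hpos : forall a : R, 0 <= a -> 0 < h a)
    (hmono : forall a b : R, 0 <= a -> a <= b -> h a <= h b)
    (Theta : R) (hTheta : 0 < Theta)
    (hdecrease : forall k : nat, (k%:R%:E < stopping_time A criterion eps)%E ->
       Theta * h (alpha A k) <= Phi k - Phi k.+1) :
  (stopping_time A criterion eps <= (Phi 0%N / (Theta * h alpha_low))%:E)%E.
Proof.
have c_gt0 : 0 < Theta * h alpha_low by rewrite mulr_gt0 // hpos // ltW.
have dec k : (k%:R%:E < stopping_time A criterion eps)%E ->
    Theta * h alpha_low <= Phi k - Phi k.+1.
  (* Monotonicity of [h] with [hlower] makes the decrease uniform in [k]. *)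
  move=> /hdecrease; apply: le_trans.
  by rewrite ler_pM2l // hmono // ltW.
move: dec; rewrite /stopping_time; case: pselect => [ex|_] dec.
  rewrite lee_fin; apply: steps_le_of_decrease => // k k_lt.
  by apply: dec; rewrite lte_fin ltr_nat.
set B := Phi 0%N / _.
have B_ge0 : 0 <= B by rewrite divr_ge0 // ltW.
(* With no stopping index every [N] is admissible; [Num.bound B] is an integer above [B], so the
   lemma yields [B < B]. *)
have /(lt_le_trans (archi_boundP B_ge0)) : (Num.bound B)%:R <= B.
  by apply: steps_le_of_decrease => // k _; apply: dec; rewrite ltry.
by rewrite ltxx.
Qed.
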